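(* Every operator system (in the nonunital sense defined in the context) has a complete order embedding into a product of matrix algebras. That is: for every operator system $S$ there exist a family $(k_i)_{i\in J}$ of positive integers and a $*$-preserving linear map $\Psi\colon S\to\prod_{i\in J}M_{k_i}$ such that for every $n\ge1$ and every $x\in M_n(S)_h$, one has $x\ge0$ if and only if $M_n(\Psi)(x)\ge0$.
   Context: A regularly ordered Banach space is a real Banach space $V$ with a closed convex cone $V_+$ such that: (1) $-y\le x\le y$ implies $\|x\|\le\|y\|$; (2) for every $x$ with $\|x\|<1$ there is $y\in V_+$ with $\|y\|<1$ and $-y\le x\le y$. For a complex $*$-vector space $S$, $M_n(S)$ is the $*$-vector space of $n\times n$ matrices over $S$ and $M_n(S)_h$ its Hermitian part. An operator system is a complex $*$-vector space $S$ equipped with a regularly ordered Banach space structure on $M_n(S)_h$ for every $n\ge1$ such that: (i) for all $m,n$ and every scalar matrix $\alpha\in M_{n,m}$ with $\|\alpha\|\le1$, the map $M_n(S)_h\to M_m(S)_h$, $x\mapsto\alpha^*x\alpha$ is positive and contractive; (ii) $\left\|\begin{pmatrix}x&0\\0&x\end{pmatrix}\right\|=\|x\|$ for all $x\in M_n(S)_h$ and all $n$. $M_k$ is the algebra of complex $k\times k$ matrices with its usual matrix ordering: $M_n(M_k)_h\cong(M_{nk})_h$ carries the positive semidefinite cone. The product $\prod_{i\in J}M_{k_i}$ is the $*$-vector space of families $(x_i)_{i\in J}$ with $x_i\in M_{k_i}$ that are uniformly bounded in trace norm, $\sup_i\|x_i\|_1<\infty$; a Hermitian element of $M_n\bigl(\prod_i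 M_{k_i}\bigr)$ is positive if and only if each of its components in $M_n(M_{k_i})$ is positive semidefinite. *)

(* Defs.v *)
From mathcomp Require Import all_boot all_order all_algebra.
From mathcomp Require Import complex.
From mathcomp Require Import all_classical all_reals all_analysis.

Set Implicit Arguments.
Unset Strict Implicit.
Unset Printing Implicit Defensive.

Import Order.TTheory GRing.Theory Num.Theory.
Import numFieldNormedType.Exports.

Local Open Scope classical_set_scope.
Local Open Scope ring_scope.
Local Open Scope sesquilinear_scope.

(* The inequality a <= b in V is encoded as P (b - a). *)
Record regularly_ordered (R : realType) (V : completeNormedModType R)
    (P : set V) : Prop := RegularlyOrdered {
  cone_closed : closed P;
  cone0 : P 0;
  coneD : forall x y, P x -> P y -> P (x + y);
  coneZ : forall (a : R) x, 0 <= a -> P x -> P (a *: x);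
  norm_monotone : forall x y, P (x - - y) -> P (y - x) -> `|x| <= `|y|;
  norm_dominated : forall x, `|x| < 1 ->
    exists y, [/\ P y, `|y| < 1, P (x - - y) & P (y - x)]
}.

Record starSpace (R : realType) := StarSpace {
  star_car :> lmodType R[i];
  star : star_car -> star_car;
  starD : forall x y, star (x + y) = star x + star y;
  starZ : forall (a : R[i]) x, star (a *: x) = a^* *: star x;
  starK : involutive star
}.

Definition hermitian_mx (R : realType) (S : starSpace R) n (X : 'M[S]_n) :=
  forall i j, X i j = star (X j i).

(* alpha^* X alpha *)
Definition compress (R : realType) (S : starSpace R) n m
    (alpha : 'M[R[i]]_(n, m)) (X : 'M[S]_n) : 'M[S]_m :=
  \matrix_(i, j) \sum_k \sum_l ((alpha k i)^* * alpha l j) *: X k l.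

Definition l2norm (R : realType) n (v : 'cV[R[i]]_n) : R :=
  Num.sqrt (\sum_i Normc.normc (v i 0) ^+ 2).

Definition opnorm (R : realType) n m (alpha : 'M[R[i]]_(n, m)) : R :=
  sup [set l2norm (alpha *m v) | v in [set v : 'cV[R[i]]_m | l2norm v <= 1]].

(* The Hermitian matrices M_n(S)_h carry their Banach space structure through
   a real Banach space [os_herm n] and an R-linear bijection [os_mx n] of it
   onto M_n(S)_h.  Only n >= 1 is constrained: [os_herm 0] is irrelevant. *)
Record operatorSystem (R : realType) := OperatorSystem {
  os_space :> starSpace R;
  os_herm : nat -> completeNormedModType R;
  os_mx : forall n, os_herm n -> 'M[os_space]_n;
  os_pos : forall n, set (os_herm n);
  os_mx_linear : forall n, (0 < n)%N -> forall (a : R) (x y : os_herm n),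
    os_mx (a *: x + y) = map_mx (fun s => (a%:C)%C *: s) (os_mx x) + os_mx y;
  os_mx_inj : forall n, (0 < n)%N -> injective (@os_mx n);
  os_mx_range : forall n, (0 < n)%N ->
    range (@os_mx n) = [set X | hermitian_mx X];
  os_regular : forall n, (0 < n)%N -> regularly_ordered (@os_pos n);
  os_compress : forall n m, (0 < n)%N -> (0 < m)%N ->
    forall alpha : 'M[R[i]]_(n, m), opnorm alpha <= 1 ->
    forall (x : os_herm n) (y : os_herm m),
      os_mx y = compress alpha (os_mx x) ->
      (os_pos x -> os_pos y) /\ `|y| <= `|x|;
  os_diag : forall n, (0 < n)%N ->
    forall (x : os_herm n) (y : os_herm (n + n)),
      os_mx y = block_mx (os_mx x) 0 0 (os_mx x) -> `|y| = `|x|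
}.

Definition psd (R : realType) n (A : 'M[R[i]]_n) : Prop :=
  A \is hermsymmx /\ forall v : 'rV[R[i]]_n, 0 <= (v *m A *m v^t*) 0 0.

(* M_n(M_k) is identified with M_{nk} by reading a matrix of blocks as a
   block matrix; the size \sum_(i < n) k is n * k. *)
Definition mx_psd (R : realType) n k (X : 'M['M[R[i]]_k]_n) : Prop :=
  psd (\mxblock_(i < n, j < n) X i j).

(* The sum of the singular values: the entries of the spectral diagonal of the
   Hermitian matrix A^* A are its eigenvalues with multiplicity. *)
Definition trace_norm (R : realType) k (A : 'M[R[i]]_k) : R :=
  \sum_i Num.sqrt (complex.Re (spectral_diag (A^t* *m A) 0 i)).

(* The vector space operations and the involution of the product are
   componentwise. *)
Record matprod (R : realType) (J : Type) (k : J -> nat) := Matprod {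
  component :> forall i : J, 'M[R[i]]_(k i);
  component_bounded : has_ubound (range (fun i => trace_norm (component i)))
}.

Definition matprod_pos (R : realType) (J : Type) (k : J -> nat) n
    (X : 'M[matprod R k]_n) : Prop :=
  forall i : J, mx_psd (map_mx (fun f : matprod R k => f i) X).

(* Main.v *)
Require Import Defs.
From mathcomp Require Import all_boot all_order all_algebra.
From mathcomp Require Import complex ring lra.
From mathcomp Require Import all_classical all_reals all_analysis.

(* If x in M_n(S)_h is not positive, Hahn-Banach separates x from the closed cone
   by a positive functional f with f x < 0.  Extend f to a complex functional F
   on M_n(S).  The map phi s := (F (E_kl (x) s))_kl from S to M_n satisfies
   sum_ij conj(a_i) phi(X_ij) a_j = F (compress alpha X), so that compatibility
   of the cones with compressions makes phi completely positive, while the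
   vector sum_i e_i (x) e_i shows that phi does not send x to a positive matrix.
   Rescaling f changes nothing here, and making it small in terms of n gives a
   bound on the trace norm of phi s that depends on s only.  So all completely
   positive maps obeying this bound form the required family.  Hahn-Banach
   itself is proved by observing that a minimal sublinear functional is linear. *)

Set Implicit Arguments.
Unset Strict Implicit.
Unset Printing Implicit Defensive.

Import Order.TTheory GRing.Theory Num.Theory.
Import numFieldNormedType.Exports.

Local Open Scope classical_set_scope.
Local Open Scope ring_scope.
Local Open Scope sesquilinear_scope.

(** * The Hahn-Banach theorem and separation from a closed cone *)

Section HahnBanach.
Variables (R : realType) (V : lmodType R).
Implicit Types (p q f g h : V -> R) (A : set (V -> R)) (x y : V).

(** Homogeneity is asked only as an inequality, the form that infima inherit most directly; applying
    it to the inverse scalar gives equality. *)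
Definition sublinear p :=
  (forall x y, p (x + y) <= p x + p y) /\
  (forall (a : R) x, 0 < a -> p (a *: x) <= a * p x).

Lemma sublinearZ p (a : R) x : sublinear p -> 0 <= a -> p (a *: x) = a * p x.
Proof.
move=> [_ pZ]; have pZ' b y : 0 < b -> p (b *: y) = b * p y.
  move=> b0; apply/eqP; rewrite eq_le pZ //=.
  have bi0 : 0 < b^-1 by rewrite invr_gt0.
  rewrite mulrC -ler_pdivlMr // mulrC -{1}[y](scalerK (lt0r_neq0 b0)).
  exact: pZ.
rewrite le_eqVlt => /predU1P[<-|]; last exact: pZ'.
(* Homogeneity at 0 with factor 2 reads [p 0 = 2 * p 0], so [p 0 = 0]. *)
rewrite mul0r scale0r; have := pZ' 2%:R 0 (ltr0Sn _ _).
by rewrite scaler0; lra.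
Qed.

Lemma sublinear_opp p x : sublinear p -> - p (- x) <= p x.
Proof.
move=> p_sub; have := p_sub.1 x (- x).
by rewrite subrr -(scale0r x) sublinearZ // mul0r; lra.
Qed.

Definition lower_envelope A x := inf [set f x | f in A].

Section Envelope.
Variables (A : set (V -> R)) (m : V -> R).
Hypotheses (A0 : A !=set0) (A_ge : forall f x, A f -> m x <= f x).

(** The common lower bound [m] ensures that [inf] is a true infimum and not a default value. *)
Lemma lower_envelope_le f x : A f -> lower_envelope A x <= f x.
Proof.
move=> Af; apply: ge_inf; last by exists f.
by exists (m x) => _ [g Ag <-]; exact: A_ge.
Qed.

Lemma lower_envelope_ge (c : R) x :
  (forall f, A f -> c <= f x) -> c <= lower_envelope A x.
Proof.
move=> cA; apply: lb_le_inf => [|_ [f Af <-]]; last exact: cA.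
by have [f Af] := A0; exists (f x), f.
Qed.

(** Members of [A] need not be sublinear themselves: a third member may absorb a sum. In a chain the
    smaller of the two serves; in a family with parameters in a cone or half-line, the parameters
    add up. *)
Lemma lower_envelope_sublinear :
  (forall f g x y, A f -> A g -> exists2 h, A h & h (x + y) <= f x + g y) ->
  (forall f (a : R) x, A f -> 0 < a -> exists2 h, A h & h (a *: x) <= a * f x) ->
  sublinear (lower_envelope A).
Proof.
move=> AD AZ; split=> [x y|a x a0].
  rewrite -lerBlDr; apply: lower_envelope_ge => f Af.
  rewrite lerBlDr -lerBlDl; apply: lower_envelope_ge => g Ag.
  have [h Ah hle] := AD f g x y Af Ag.
  by have := lower_envelope_le (x + y) Ah; lra.
rewrite mulrC -ler_pdivrMr //; apply: lower_envelope_ge => f Af.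
have [h Ah hle] := AZ f a x Af a0; rewrite ler_pdivrMr // mulrC.
exact: le_trans (lower_envelope_le _ Ah) hle.
Qed.

End Envelope.

(* The largest sublinear q <= p with q (- y) <= - p y. *)
Definition tilt p y := lower_envelope
  [set f | exists2 t : R, 0 <= t & f = fun x => p (x + t *: y) - t * p y].

(** Subadditivity at [x + t *: y] and [- x]. This keeps the infimum defining [tilt] finite. *)
Lemma tilt_ge p y f x : sublinear p ->
  (exists2 t : R, 0 <= t & f = fun x => p (x + t *: y) - t * p y) ->
  - p (- x) <= f x.
Proof.
move=> p_sub [t t0 ->]; have := p_sub.1 (x + t *: y) (- x).
by rewrite addrAC subrr add0r sublinearZ //; lra.
Qed.

Lemma tilt_le p y x (t : R) : sublinear p -> 0 <= t ->
  tilt p y x <= p (x + t *: y) - t * p y.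
Proof.
move=> p_sub t0.
apply: (@lower_envelope_le _ (fun x => - p (- x))
  _ (fun x => p (x + t *: y) - t * p y)); last by exists t.
by move=> f z; exact: tilt_ge.
Qed.

Lemma tilt_sublinear p y : sublinear p -> sublinear (tilt p y).
Proof.
move=> p_sub; apply: (@lower_envelope_sublinear _ (fun x => - p (- x))).
- by exists (fun x => p (x + 0 *: y) - 0 * p y), 0.
- by move=> f x; exact: tilt_ge.
- move=> _ _ x z [s s0 ->] [t t0 ->].
  exists (fun x => p (x + (s + t) *: y) - (s + t) * p y).
    by exists (s + t); rewrite ?addr_ge0.
  have := p_sub.1 (x + s *: y) (z + t *: y).
  by rewrite addrACA scalerDl; lra.
- move=> _ a x [t t0 ->] a0.
  exists (fun x => p (x + (a * t) *: y) - (a * t) * p y).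
    by exists (a * t); rewrite ?mulr_ge0 // ltW.
  by rewrite -scalerA -scalerDr sublinearZ ?(ltW a0) // mulrBr mulrA.
Qed.

(** Zorn's lemma for the reversed pointwise order. A nonempty chain is bounded by its lower
    envelope, which is finite because each sublinear [q <= p] satisfies
    [- p (- x) <= - q (- x) <= q x]. *)
Lemma minimal_sublinear p : sublinear p ->
  exists q, [/\ sublinear q, forall x, q x <= p x &
    forall r, sublinear r -> (forall x, r x <= q x) -> r = q].
Proof.
move=> p_sub; pose T := {q | sublinear q /\ forall x, q x <= p x}.
pose le (q r : T) := `[< forall x, sval r x <= sval q x >].
have := @Zorn T le; case.
- by move=> q; apply/asboolP.
- move=> q r s /asboolP qr /asboolP rs; apply/asboolP => x.
  exact: le_trans (rs x) (qr x).
- move=> [q Pq] [r Pr] /asboolP /= qr /asboolP /= rq.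
  by apply: eq_exist; apply/funext => x; apply/eqP; rewrite eq_le rq qr.
- move=> A A_tot; have [A0|/set0P A0] := eqVneq A set0.
    by exists (exist _ p (conj p_sub (fun x => lexx _))) => s; rewrite A0.
  pose B : set (V -> R) := [set sval q | q in A].
  have B0 : B !=set0 by have [q Aq] := A0; exists (sval q), q.
  have B_ge f x : B f -> - p (- x) <= f x.
    move=> [[q [q_sub qp]] _ <-] /=; apply: le_trans (sublinear_opp x q_sub).
    by rewrite lerN2.
  have e_sub : sublinear (lower_envelope B).
    apply: (lower_envelope_sublinear B0 B_ge).
    - move=> _ _ x y [q Aq <-] [r Ar <-].
      have [/asboolP qr|/asboolP rq] := A_tot _ _ Aq Ar.
        exists (sval r); first by exists r.
        by apply: le_trans ((svalP r).1.1 x y) _; rewrite lerD2r.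
      exists (sval q); first by exists q.
      by apply: le_trans ((svalP q).1.1 x y) _; rewrite lerD2l.
    - move=> _ a x [q Aq <-] a0; exists (sval q); first by exists q.
      exact: (svalP q).1.2.
  have e_le x : lower_envelope B x <= p x.
    have [f [q Aq qf]] := B0; apply: le_trans ((svalP q).2 x).
    by apply: (lower_envelope_le B_ge); exists q.
  exists (exist _ (lower_envelope B) (conj e_sub e_le)) => q Aq.
  by apply/asboolP => x /=; apply: (lower_envelope_le B_ge); exists q.
- move=> [q [q_sub qp]] q_min; exists q; split=> // r r_sub rq.
  have rp x : r x <= p x := le_trans (rq x) (qp x).
  have /(_ _)/(congr1 sval) := q_min (exist _ r (conj r_sub rp)).
  by apply; apply/asboolP.
Qed.

(* Minimality gives [tilt q y = q], hence [q x + q y <= q (x + y)]. *)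
Lemma minimal_sublinear_linear q : sublinear q ->
  (forall r, sublinear r -> (forall x, r x <= q x) -> r = q) ->
  forall (a : R) x y, q (a *: x + y) = a * q x + q y.
Proof.
move=> q_sub q_min.
have qD x y : q (x + y) = q x + q y.
  have tq : tilt q y = q.
    apply: q_min => [|z]; first exact: tilt_sublinear.
    have := tilt_le y z q_sub (lexx 0).
    by rewrite scale0r addr0 mul0r subr0.
  have := tilt_le y x q_sub ler01; rewrite tq scale1r mul1r => le1.
  by have := q_sub.1 x y; lra.
have qN x : q (- x) = - q x.
  have := qD x (- x); rewrite subrr -(scale0r x) sublinearZ // mul0r; lra.
move=> a x y; rewrite qD; congr (_ + _).
have [a0|a0] := leP 0 a; first exact: sublinearZ.
rewrite -[a]opprK scaleNr qN sublinearZ ?mulNr //; lra.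
Qed.

(** The minimal functional [q] is taken below [tilt p x0], which is at most [p] (take t = 0) and at
    most [- p x0] at [- x0] (take t = 1). Linearity of [q] turns the latter into [p x0 <= q x0]. *)
Theorem hahn_banach p x0 : sublinear p ->
  exists g : V -> R, [/\ forall (a : R) x y, g (a *: x + y) = a * g x + g y,
    forall x, g x <= p x & g x0 = p x0].
Proof.
move=> p_sub; have t_sub := tilt_sublinear x0 p_sub.
have [q [q_sub qt q_min]] := minimal_sublinear t_sub.
have q_lin := minimal_sublinear_linear q_sub q_min.
have qp x : q x <= p x.
  apply: le_trans (qt x) _; have := tilt_le x0 x p_sub (lexx 0).
  by rewrite scale0r addr0 mul0r subr0.
exists q; split=> //; apply/eqP; rewrite eq_le qp /=.
have := le_trans (qt (- x0)) (tilt_le x0 (- x0) p_sub ler01).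
rewrite scale1r addNr -(scale0r x0) sublinearZ // mul0r mul1r.
have := q_lin (-1) x0 0; rewrite addr0 scaleN1r => ->.
have -> : q 0 = 0 by rewrite -(scale0r x0) sublinearZ // mul0r.
lra.
Qed.

End HahnBanach.

(** Hahn-Banach is applied to [d], which is [e] times the distance to [P]: sublinear because [P] is
    a convex cone, positive at [x0] because [P] is closed. The functional is [- g] with [g <= d];
    its sign on [P] comes from [d <= 0] there, its norm bound from the distance to the point 0 of
    [P]. *)
Lemma cone_separation (R : realType) (V : normedModType R) (P : set V)
    (x0 : V) (e : R) :
  closed P -> P 0 -> (forall x y, P x -> P y -> P (x + y)) ->
  (forall (a : R) x, 0 <= a -> P x -> P (a *: x)) -> ~ P x0 -> 0 < e ->
  exists f : V -> R, [/\ forall (a : R) x y, f (a *: x + y) = a * f x + f y,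
    forall x, P x -> 0 <= f x, f x0 < 0 & forall x, `|f x| <= e * `|x|].
Proof.
move=> P_closed P0 PD PZ nPx0 e0.
pose A : set (V -> R) :=
  [set f | exists2 c, P c & f = fun x : V => e * `|x - c|].
have A0 : A !=set0 by exists (fun x => e * `|x - 0|), 0.
have A_ge f x : A f -> (0 : V -> R) x <= f x.
  by move=> [c _ ->]; rewrite mulr_ge0 // ltW.
pose d := lower_envelope A.
have d_sub : sublinear d.
  apply: (lower_envelope_sublinear A0 A_ge).
  - move=> _ _ x y [b Pb ->] [c Pc ->].
    exists (fun x => e * `|x - (b + c)|); first by exists (b + c) => //; exact: PD.
    by rewrite opprD addrACA -mulrDr ler_pM2l // ler_normD.
  - move=> _ a x [c Pc ->] a0.
    exists (fun x => e * `|x - a *: c|).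
      by exists (a *: c) => //; exact/PZ/Pc/ltW.
    by rewrite -scalerBr normrZ (gtr0_norm a0) mulrCA.
have d_le (c x : V) : P c -> d x <= e * `|x - c|.
  move=> Pc; apply: (lower_envelope_le A_ge (f := fun x => e * `|x - c|)).
  by exists c.
have d_gt0 : 0 < d x0.
  have : nbhs x0 (~` P) by apply: open_nbhs_nbhs; split=> //; exact: closed_openC.
  move=> /nbhs_ballP[r /= r0 rP]; apply: (@lt_le_trans _ _ (e * r)).
    exact: mulr_gt0.
  apply: lower_envelope_ge => // _ [c Pc ->]; rewrite ler_pM2l // leNgt.
  by apply/negP => xc; apply: (rP c) => //; rewrite -ball_normE.
have [g [g_lin g_le gx0]] := hahn_banach x0 d_sub.
have g0 : g 0 = 0 by have := g_lin 1 0 0; rewrite scale1r addr0; lra.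
have gN x : g (- x) = - g x.
  by have := g_lin (-1) x 0; rewrite scaleN1r addr0 g0; lra.
exists (fun x => - g x); split.
- by move=> a x y; rewrite g_lin; lra.
- move=> x Px; have := le_trans (g_le x) (d_le x x Px).
  by rewrite subrr normr0 mulr0; lra.
- by rewrite gx0; lra.
- move=> x; rewrite normrN; have gl y : g y <= e * `|y|.
    by apply: le_trans (g_le y) _; rewrite -{2}[y]subr0; exact: d_le.
  by rewrite ler_norml gl andbT; have := gl (- x); rewrite gN normrN; lra.
Qed.

(** * Estimates for the trace norm and the operator norm *)

Lemma conjC_mul_normc (R : realType) (a : R[i]) :
  a^* * a = (Normc.normc a ^+ 2)%:C%C.
Proof. by rewrite mulrC -normCK rmorphXn. Qed.

(** The eigenvalues of A^* A sum to its trace, which is the squared Hilbert-Schmidt norm of [A];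
    their square roots are then estimated one by one. *)
Lemma trace_norm_le (R : realType) k (A : 'M[R[i]]_k) :
  trace_norm A <= 1 + k%:R * \sum_i \sum_j Normc.normc (A i j) ^+ 2.
Proof.
set B := A^t* *m A; set d := spectral_diag B; set P := spectralmx B.
have BE : B = invmx P *m diag_mx d *m P.
  apply/orthomx_spectralP/hermitian_normalmx/is_hermitianmxP.
  by rewrite expr0 scale1r /B trmx_mul map_mxM trmxCK.
have P_unitary : P \is unitarymx := spectral_unitarymx B.
(* Each eigenvalue is thus the squared norm of a column of [A *m P^t*], hence real and
   nonnegative. *)
have dE : diag_mx d = (A *m P^t*)^t* *m (A *m P^t*).
  rewrite trmx_mul map_mxM trmxCK !mulmxA -[_ *m A]mulmxA -/B BE.
  rewrite !mulmxA mulmxV ?spectral_unit // mul1mx -mulmxA.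
  by rewrite (unitarymxP P_unitary) mulmx1.
pose r i := \sum_j Normc.normc ((A *m P^t*) j i) ^+ 2.
have dr i : d 0 i = (r i)%:C%C.
  have /matrixP/(_ i i) := dE; rewrite !mxE eqxx mulr1n => ->.
  rewrite rmorph_sum; apply: eq_bigr => j _ /=.
  by rewrite !mxE -conjC_mul_normc.
have r_ge0 i : 0 <= r i by apply: sumr_ge0 => j _; exact: sqr_ge0.
have sum_r : \sum_i r i = \sum_i \sum_j Normc.normc (A i j) ^+ 2.
  apply: (@fmorph_inj _ _ (real_complex R)).
  rewrite rmorph_sum; under eq_bigr do rewrite /= -dr.
  rewrite -mxtrace_diag -(mulmx1 (diag_mx d)) -(mulmxV (spectral_unit B)).
  rewrite mulmxA mxtrace_mulC mulmxA -BE exchange_big rmorph_sum.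
  apply: eq_bigr => i _; rewrite mxE rmorph_sum.
  by apply: eq_bigr => j _; rewrite !mxE conjC_mul_normc.
(* Termwise, [sqrt r <= 1/k + k r]. *)
rewrite -sum_r mulr_sumr /trace_norm -/B -/d.
have [k0|k_gt0] := posnP k.
  have no_i (i : 'I_k) : False by have := ltn_ord i; rewrite [X in (_ < X)%N]k0.
  by rewrite !big1 ?addr0 ?ler01 // => i; case: (no_i i).
have kR : 0 < k%:R :> R by rewrite ltr0n.
rewrite [X in _ <= X + _](_ : 1 = \sum_(i < k) k%:R^-1); last first.
  by rewrite sumr_const card_ord -[RHS]mulr_natl divff // lt0r_neq0.
rewrite -big_split; apply: ler_sum => i _; rewrite dr /=.
have := sqr_sqrtr (r_ge0 i); set s := Num.sqrt _ => <-.
have s0 : 0 <= s by exact: sqrtr_ge0.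
have : 0 <= (k%:R * s - 1) ^+ 2 / k%:R by rewrite divr_ge0 ?sqr_ge0 // ltW.
have -> : (k%:R * s - 1) ^+ 2 / k%:R = k%:R * s ^+ 2 - 2 * s + k%:R^-1 :> R.
  by field; exact: lt0r_neq0.
by rewrite /=; lra.
Qed.

Lemma normc_ge0 (R : realType) (a : R[i]) : 0 <= Normc.normc a.
Proof. by case: a => ? ?; exact: sqrtr_ge0. Qed.

Lemma l2norm_le_sum (R : realType) n (v : 'cV[R[i]]_n) :
  l2norm v <= \sum_i Normc.normc (v i 0).
Proof.
rewrite /l2norm; set s := \sum_i Normc.normc _.
have s0 : 0 <= s by apply: sumr_ge0 => i _; exact: normc_ge0.
rewrite -(ger0_norm s0) -sqrtr_sqr; apply: ler_wsqrtr.
rewrite expr2 {1}/s mulr_suml; apply: ler_sum => i _.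
rewrite expr2 ler_wpM2l ?normc_ge0 // /s (bigD1 i) //= lerDl.
by apply: sumr_ge0 => j _; exact: normc_ge0.
Qed.

Lemma normc_le_l2norm (R : realType) n (v : 'cV[R[i]]_n) i :
  Normc.normc (v i 0) <= l2norm v.
Proof.
rewrite -(ger0_norm (normc_ge0 _)) -sqrtr_sqr; apply: ler_wsqrtr.
by rewrite (bigD1 i) //= lerDl; apply: sumr_ge0 => j _; exact: sqr_ge0.
Qed.

(** A crude bound suffices: it serves to rescale an arbitrary scalar matrix to a contraction. *)
Lemma opnorm_le_sum (R : realType) n m (alpha : 'M[R[i]]_(n, m)) :
  opnorm alpha <= \sum_i \sum_j Normc.normc (alpha i j).
Proof.
apply: ge_sup.
  exists (l2norm (alpha *m 0)), 0 => //=.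
  apply: le_trans (l2norm_le_sum _) _.
  by rewrite big1 // => i _; rewrite mxE Normc.normc0.
move=> _ [v /= v1 <-]; apply: le_trans (l2norm_le_sum _) _.
apply: ler_sum => i _; rewrite mxE.
have normc_sum (I : Type) (s : seq I) (F : I -> R[i]) :
    Normc.normc (\sum_(j <- s) F j) <= \sum_(j <- s) Normc.normc (F j).
  elim/big_rec2: _ => [|j y1 y2 _ IH]; first by rewrite Normc.normc0.
  by apply: le_trans (le_normcD _ _) _; rewrite lerD2l.
apply: le_trans (normc_sum _ _ _) _; apply: ler_sum => j _.
rewrite Normc.normcM ler_piMr ?normc_ge0 //.
exact: le_trans (normc_le_l2norm _ _) v1.
Qed.

Lemma conjC_real (R : realType) (a : R) : (a%:C%C : R[i])^* = a%:C%C.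
Proof. exact: conjc_real. Qed.

(** * Hermitian matrices over an operator system and their compressions *)

Section OperatorSystem.
Variables (R : realType) (S : operatorSystem R).
Implicit Types (n m : nat) (s t : S).

Definition scalemx_os n (a : R[i]) (Z : 'M[S]_n) : 'M[S]_n :=
  map_mx (fun s => a *: s) Z.

Definition adjmx n (Z : 'M[S]_n) : 'M[S]_n := \matrix_(i, j) star (Z j i).

Lemma star0 : star 0 = 0 :> S.
Proof. by have := starZ 0 (0 : S); rewrite rmorph0 !scale0r. Qed.

Lemma os_mx0 n : (0 < n)%N -> os_mx (0 : os_herm S n) = 0.
Proof.
move=> n_gt0; have := os_mx_linear n_gt0 1 (0 : os_herm S n) 0.
rewrite scale1r addr0 => e; apply: (addrI (os_mx (0 : os_herm S n))).
rewrite addr0 [in RHS]e; congr (_ + _); apply/matrixP => i j.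
by rewrite mxE scale1r.
Qed.

Lemma os_mxD n (x y : os_herm S n) : (0 < n)%N ->
  os_mx (x + y) = os_mx x + os_mx y.
Proof.
move=> n_gt0; have := os_mx_linear n_gt0 1 x y; rewrite scale1r => ->.
by congr (_ + _); apply/matrixP => i j; rewrite mxE scale1r.
Qed.

Lemma os_mxZ n (a : R) (x : os_herm S n) : (0 < n)%N ->
  os_mx (a *: x) = scalemx_os (a%:C)%C (os_mx x).
Proof.
by move=> n_gt0; have := os_mx_linear n_gt0 a x 0; rewrite os_mx0 // !addr0.
Qed.

Lemma os_mx_hermitian n (x : os_herm S n) : (0 < n)%N -> hermitian_mx (os_mx x).
Proof.
move=> n_gt0; have : range (@os_mx R S n) (os_mx x) by exists x.
by rewrite os_mx_range.
Qed.

(* The inverse of [os_mx] on Hermitian matrices; junk elsewhere. *)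
Definition of_mx n (X : 'M[S]_n) : os_herm S n :=
  xget 0 [set x | os_mx x = X].

Lemma of_mxK n (X : 'M[S]_n) : (0 < n)%N -> hermitian_mx X ->
  os_mx (of_mx X) = X.
Proof.
move=> n_gt0 hX; rewrite /of_mx; case: xgetP => [x -> //|noX].
have : range (@os_mx R S n) X by rewrite os_mx_range.
by move=> [x _ xX]; case: (noX x).
Qed.

Lemma os_mxK n (x : os_herm S n) : (0 < n)%N -> of_mx (os_mx x) = x.
Proof.
move=> n_gt0; apply: (os_mx_inj n_gt0); apply: of_mxK => //.
exact: os_mx_hermitian.
Qed.

Lemma of_mxD n (X Y : 'M[S]_n) : (0 < n)%N ->
  hermitian_mx X -> hermitian_mx Y -> of_mx (X + Y) = of_mx X + of_mx Y.
Proof.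
move=> n_gt0 hX hY; apply: (os_mx_inj n_gt0).
rewrite os_mxD // !of_mxK // => i j.
by rewrite !mxE starD -hX -hY.
Qed.

Lemma of_mxZ n (a : R) (X : 'M[S]_n) : (0 < n)%N -> hermitian_mx X ->
  of_mx (scalemx_os (a%:C)%C X) = a *: of_mx X.
Proof.
move=> n_gt0 hX; apply: (os_mx_inj n_gt0).
rewrite os_mxZ // !of_mxK // => i j; rewrite !mxE starZ -hX.
by rewrite conjC_real.
Qed.

Lemma compressZ n m (c : R) (alpha : 'M[R[i]]_(n, m)) (X : 'M[S]_n) :
  compress ((c%:C)%C *: alpha) X = scalemx_os ((c ^+ 2)%:C)%C (compress alpha X).
Proof.
apply/matrixP => i j; rewrite !mxE scaler_sumr; apply: eq_bigr => k _.
rewrite scaler_sumr; apply: eq_bigr => l _; rewrite scalerA; congr (_ *: _).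
rewrite !mxE rmorphM rmorphXn /= conjC_real.
by rewrite expr2 mulrACA.
Qed.

Lemma compress_hermitian n m (alpha : 'M[R[i]]_(n, m)) (X : 'M[S]_n) :
  hermitian_mx X -> hermitian_mx (compress alpha X).
Proof.
move=> hX i j; rewrite !mxE.
have star_sum (I : Type) (r : seq I) (F : I -> S) :
    star (\sum_(k <- r) F k) = \sum_(k <- r) star (F k).
  exact: (big_morph _ (@starD _ _) star0).
rewrite star_sum exchange_big; apply: eq_bigr => k _.
rewrite star_sum; apply: eq_bigr => l _.
by rewrite starZ -hX rmorphM /= conjCK mulrC.
Qed.

(** Dividing [alpha] by [M] makes it a contraction. Compression is quadratic in [alpha], so the
    result is divided by [M ^+ 2]; this affects the norm by that factor and positivity not at
    all. *)
Lemma os_compress_le n m (alpha : 'M[R[i]]_(n, m))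
    (x : os_herm S n) (y : os_herm S m) :
  (0 < n)%N -> (0 < m)%N -> os_mx y = compress alpha (os_mx x) ->
  (os_pos x -> os_pos y) /\
  `|y| <= (1 + \sum_i \sum_j Normc.normc (alpha i j)) ^+ 2 * `|x|.
Proof.
(* The summand 1 keeps [M] invertible even for [alpha] zero. *)
move=> n_gt0 m_gt0 yx; set M := 1 + _.
have sum_ge0 : 0 <= M - 1.
  rewrite /M addrAC subrr add0r.
  by do 2 (apply: sumr_ge0 => ? _); exact: normc_ge0.
have M1 : 1 <= M by rewrite -subr_ge0.
have M0 : 0 < M by exact: lt_le_trans M1.
have op1 : opnorm ((M^-1%:C)%C *: alpha) <= 1.
  apply: le_trans (opnorm_le_sum _) _.
  under eq_bigr => i _.
    under eq_bigr => j _.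
      rewrite mxE Normc.normcM [Normc.normc (_%:C)%C]/= expr0n addr0 sqrtr_sqr.
      rewrite gtr0_norm ?invr_gt0 //.
      over.
    rewrite -mulr_sumr; over.
  by rewrite -mulr_sumr mulrC ler_pdivrMr // mul1r /M lerDr.
have [P_le N_le] := os_compress n_gt0 m_gt0 op1 (x := x) (y := (M^-1 ^+ 2) *: y)
  (etrans (os_mxZ _ _ m_gt0)
     (etrans (congr1 _ yx) (esym (compressZ _ _ _)))).
split=> [/P_le|].
  move=> /(coneZ (os_regular S m_gt0) (sqr_ge0 M)).
  by rewrite scalerA -exprMn divff ?expr1n ?scale1r // lt0r_neq0.
move: N_le; rewrite normrZ ger0_norm ?sqr_ge0 // exprVn mulrC.
by rewrite ler_pdivrMr ?exprn_gt0 // mulrC.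
Qed.

Definition unit_mx n (k l : 'I_n) s : 'M[S]_n :=
  \matrix_(i, j) if (i == k) && (j == l) then s else 0.

Lemma adj_unit_mx n (k l : 'I_n) s :
  adjmx (unit_mx k l s) = unit_mx l k (star s).
Proof.
apply/matrixP => i j; rewrite !mxE andbC.
by case: ifP; rewrite ?star0.
Qed.

(** Expansion in elementary tensors E_kl (x) s, on which a linear functional can be evaluated term
    by term. *)
Lemma compress_unit_mx n m (alpha : 'M[R[i]]_(m, n)) (X : 'M[S]_m) :
  compress alpha X = \sum_i \sum_j \sum_k \sum_l
    scalemx_os ((alpha i k)^* * alpha j l) (unit_mx k l (X i j)).
Proof.
apply/matrixP => p q; rewrite !mxE summxE; apply: eq_bigr => i _.
rewrite summxE; apply: eq_bigr => j _; rewrite summxE (bigD1 p) //=.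
rewrite [X in _ + X]big1 => [|k kp]; last first.
  rewrite summxE big1 // => l _; rewrite !mxE.
  by rewrite eq_sym (negPf kp) scaler0.
rewrite addr0 summxE (bigD1 q) //= big1 => [|l lq]; last first.
  by rewrite !mxE [q == l]eq_sym (negPf lq) andbF scaler0.
by rewrite addr0 !mxE !eqxx.
Qed.

(** Norms exist only on Hermitian matrices; this one gives an arbitrary [s] a size. *)
Definition offdiag_mx s : 'M[S]_2 := \matrix_(i, j)
  if i == j then 0 else if i == 0 then s else star s.

Lemma offdiag_hermitian s : hermitian_mx (offdiag_mx s).
Proof.
move=> i j; rewrite !mxE [j == i]eq_sym; case: eqVneq => [|ij].
  by rewrite star0.
have [i0|i1] := eqVneq i 0; have [j0|j1] := eqVneq j 0; rewrite ?starK //.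
  by rewrite i0 j0 eqxx in ij.
case/negP: ij; apply/eqP/val_inj.
by move: i j i1 j1 => [[|[|?]] ?] [[|[|?]] ?].
Qed.

(* Its compression of [offdiag_mx s] is E_kl (x) s plus its adjoint, which bounds
   that Hermitian matrix by a quantity independent of n, k and l. *)
Definition unit_pair_mx n (k l : 'I_n) : 'M[R[i]]_(2, n) :=
  \matrix_(i, j) (if i == 0 then (j == k)%:R else (j == l)%:R).

Lemma compress_unit_pair n (k l : 'I_n) s :
  compress (unit_pair_mx k l) (offdiag_mx s) =
  unit_mx k l s + adjmx (unit_mx k l s).
Proof.
apply/matrixP => i j; rewrite !mxE !big_ord_recl !big_ord0 !mxE /=.
rewrite !addr0 !scaler0 !add0r ?addr0 !rmorph_nat -!natrM.
congr (_ + _).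
  by case: eqP => _; case: eqP => _; rewrite ?scale1r ?scale0r.
rewrite andbC.
by case: eqP => _; case: eqP => _; rewrite ?scale1r ?scale0r ?star0.
Qed.

Lemma unit_pair_sum n (k l : 'I_n) :
  \sum_i \sum_j Normc.normc (unit_pair_mx k l i j) = 2 :> R.
Proof.
have one_sum (p : 'I_n) : \sum_j Normc.normc ((j == p)%:R : R[i]) = 1 :> R.
  rewrite (bigD1 p) //= eqxx Normc.normc1 big1 ?addr0 // => j /negPf ->.
  exact: Normc.normc0.
rewrite !big_ord_recl big_ord0 addr0 -[2]/(1 + 1); congr (_ + _).
  by rewrite -[RHS](one_sum k); apply: eq_bigr => j _; rewrite mxE.
by rewrite -[RHS](one_sum l); apply: eq_bigr => j _; rewrite mxE.
Qed.

End OperatorSystem.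

(** * From a functional on M_n(S)_h to a completely positive map into M_n *)

Lemma conjCE (R : realType) (a b : R) : ((a +i* b)%C : R[i])^* = (a -i* b)%C.
Proof. by []. Qed.

(** Brings the quadratic form of a block matrix into the shape of the fourfold sum in
    [dual_map_compress]. *)
Lemma mxblock_form (R : realType) n k (B : 'I_n -> 'I_n -> 'M[R[i]]_k)
    (v : 'I_n -> 'rV[R[i]]_k) :
  (\mxrow_i v i *m \mxblock_(i < n, j < n) B i j *m (\mxrow_i v i)^t*) 0 0 =
  \sum_i \sum_j \sum_p \sum_q (v i 0 p * (v j 0 q)^*) * B i j p q.
Proof.
have -> : (\mxrow_i v i)^t* = \mxcol_i (v i)^t*.
  by rewrite tr_mxrow; apply/matrixP => i j; rewrite !mxE.
rewrite mul_mxrow_mxblock mul_mxrow_mxcol summxE exchange_big.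
apply: eq_bigr => j _; rewrite mulmx_suml summxE; apply: eq_bigr => i _.
rewrite mxE exchange_big; apply: eq_bigr => q _.
rewrite !mxE mulr_suml; apply: eq_bigr => p _.
by rewrite mulrAC.
Qed.

Section Functional.
Variables (R : realType) (S : operatorSystem R) (n : nat) (n_gt0 : (0 < n)%N).
Variables (f : os_herm S n -> R).
Hypothesis f_lin : forall (a : R) x y, f (a *: x + y) = a * f x + f y.
Implicit Types (X Y Z : 'M[S]_n) (s t : S).

Definition re_ext Z : R := f (of_mx (Z + adjmx Z)).

(* Extends [2 f], since [re_ext] is [2 f] on Hermitian matrices and vanishes on
   skew-Hermitian ones. *)
Definition cplx_ext Z : R[i] :=
  (re_ext Z +i* - re_ext (scalemx_os 'i%C Z))%C.

Lemma functionalD x y : f (x + y) = f x + f y.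
Proof. by rewrite -[x]scale1r f_lin mul1r scale1r. Qed.

Lemma functionalZ a x : f (a *: x) = a * f x.
Proof.
have f0 : f 0 = 0 by have := functionalD 0 0; rewrite addr0; lra.
by rewrite -[a *: x]addr0 f_lin f0 addr0.
Qed.

Lemma adjmxK Z : adjmx (adjmx Z) = Z.
Proof. by apply/matrixP => i j; rewrite !mxE starK. Qed.

Lemma adjmxD Y Z : adjmx (Y + Z) = adjmx Y + adjmx Z.
Proof. by apply/matrixP => i j; rewrite !mxE starD. Qed.

Lemma adjmxZ a Z : adjmx (scalemx_os a Z) = scalemx_os a^* (adjmx Z).
Proof. by apply/matrixP => i j; rewrite !mxE starZ. Qed.

Lemma hermitian_adjmx Z : hermitian_mx (Z + adjmx Z).
Proof. by move=> i j; rewrite !mxE starD starK addrC. Qed.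

Lemma scalemx_osD a Y Z : scalemx_os a (Y + Z) = scalemx_os a Y + scalemx_os a Z.
Proof. by apply/matrixP => i j; rewrite !mxE scalerDr. Qed.

Lemma scalemx_osDl a b Z :
  scalemx_os (a + b) Z = scalemx_os a Z + scalemx_os b Z.
Proof. by apply/matrixP => i j; rewrite !mxE scalerDl. Qed.

Lemma scalemx_osA a b Z : scalemx_os a (scalemx_os b Z) = scalemx_os (a * b) Z.
Proof. by apply/matrixP => i j; rewrite !mxE scalerA. Qed.

Lemma re_extD Y Z : re_ext (Y + Z) = re_ext Y + re_ext Z.
Proof.
rewrite /re_ext -functionalD -of_mxD //; [|exact: hermitian_adjmx..].
by rewrite adjmxD addrACA.
Qed.

Lemma re_extZ (a : R) Z : re_ext (scalemx_os (a%:C)%C Z) = a * re_ext Z.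
Proof.
rewrite /re_ext -functionalZ -of_mxZ //; last exact: hermitian_adjmx.
by rewrite scalemx_osD adjmxZ conjC_real.
Qed.

Lemma re_ext_adj Z : re_ext (adjmx Z) = re_ext Z.
Proof. by rewrite /re_ext adjmxK addrC. Qed.

Lemma cplx_extD Y Z : cplx_ext (Y + Z) = cplx_ext Y + cplx_ext Z.
Proof. by rewrite /cplx_ext scalemx_osD !re_extD opprD. Qed.

(** The usual complexification g(Z) - i g(iZ) of a real-linear g; the scalar is split into real and
    imaginary parts. *)
Lemma cplx_extZ a Z : cplx_ext (scalemx_os a Z) = a * cplx_ext Z.
Proof.
have reZ b c Y : re_ext (scalemx_os (b +i* c)%C Y) =
    b * re_ext Y + c * re_ext (scalemx_os 'i%C Y).
  rewrite [(_ +i* _)%C]complexE mulrC scalemx_osDl -scalemx_osA.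
  by rewrite re_extD !re_extZ.
case: a => b c; rewrite /cplx_ext scalemx_osA reZ.
have -> : 'i%C * (b +i* c)%C = (- c +i* b)%C :> R[i] by simpc.
by rewrite (reZ (- c)); simpc; congr (_ +i* _)%C; ring.
Qed.

Lemma cplx_ext0 : cplx_ext 0 = 0.
Proof.
have -> : (0 : 'M[S]_n) = scalemx_os 0 0.
  by apply/matrixP => i j; rewrite !mxE scaler0.
by rewrite cplx_extZ mul0r.
Qed.

Lemma cplx_ext_sum (I : Type) (r : seq I) (F : I -> 'M[S]_n) :
  cplx_ext (\sum_(k <- r) F k) = \sum_(k <- r) cplx_ext (F k).
Proof. exact: (big_morph _ cplx_extD cplx_ext0). Qed.

(** [re_ext] is invariant under the adjoint, and i Z^* is the adjoint of -i Z, which flips the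
    imaginary part. *)
Lemma cplx_ext_adj Z : cplx_ext (adjmx Z) = (cplx_ext Z)^*.
Proof.
rewrite /cplx_ext re_ext_adj conjCE opprK; congr (_ +i* _)%C.
rewrite -(re_ext_adj (scalemx_os _ (adjmx Z))) adjmxZ adjmxK.
have -> : ('i%C : R[i])^* = ((-1)%:C)%C * 'i%C.
  by rewrite conjCE; simpc.
by rewrite -scalemx_osA re_extZ mulN1r opprK.
Qed.

Lemma cplx_ext_hermitian (x : os_herm S n) : cplx_ext (os_mx x) = ((2 * f x)%:C)%C.
Proof.
have adj_x : adjmx (os_mx x) = os_mx x.
  by apply/matrixP => i j; rewrite mxE -os_mx_hermitian.
have : cplx_ext (os_mx x) = (cplx_ext (os_mx x))^* by rewrite -cplx_ext_adj adj_x.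
rewrite /cplx_ext conjCE => -[] im0; congr (_ +i* _)%C; last by move: im0; lra.
by rewrite /re_ext adj_x -os_mxD // os_mxK // functionalD; ring.
Qed.

Definition dual_map s : 'M[R[i]]_n := \matrix_(k, l) cplx_ext (unit_mx k l s).

Lemma dual_map_linear : linear dual_map.
Proof.
move=> a s t; apply/matrixP => k l; rewrite !mxE -cplx_extZ -cplx_extD.
congr cplx_ext.
apply/matrixP => i j; rewrite !mxE.
by case: ifP; rewrite ?scaler0 ?addr0.
Qed.

Lemma dual_map_star s : dual_map (star s) = (dual_map s)^t*.
Proof.
by apply/matrixP => k l; rewrite !mxE -cplx_ext_adj adj_unit_mx.
Qed.

(** The duality between functionals on M_n(S) and maps from S to M_n: the rows of [alpha] are the
    blocks of a test vector for the image of [X]. *)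
Lemma dual_map_compress m (alpha : 'M[R[i]]_(m, n)) (X : 'M[S]_m) :
  \sum_i \sum_j \sum_k \sum_l
    ((alpha i k)^* * alpha j l) * dual_map (X i j) k l =
  cplx_ext (compress alpha X).
Proof.
rewrite compress_unit_mx.
do 4! (rewrite cplx_ext_sum; apply: eq_bigr => ? _).
by rewrite cplx_extZ mxE.
Qed.

Lemma dual_map_hermitian m (x : os_herm S m) : (0 < m)%N ->
  \mxblock_(i < m, j < m) (map_mx dual_map (os_mx x)) i j \is hermsymmx.
Proof.
move=> m_gt0; apply/is_hermitianmxP; rewrite expr0 scale1r.
apply/matrixP => p q; rewrite !mxE os_mx_hermitian //.
by rewrite -cplx_ext_adj adj_unit_mx.
Qed.

Hypothesis f_pos : forall x, os_pos x -> 0 <= f x.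

Lemma dual_map_cp m (x : os_herm S m) : (0 < m)%N -> os_pos x ->
  mx_psd (map_mx dual_map (os_mx x)).
Proof.
move=> m_gt0 x_pos; split; first exact: dual_map_hermitian.
move=> v; rewrite -(submxrowK v); set w := submxrow v.
(* The conjugate is there because [compress] conjugates its left factor, while the quadratic form of
   a row vector conjugates the right one. *)
pose alpha : 'M[R[i]]_(m, n) := \matrix_(i, k) (w i 0 k)^*.
pose y := of_mx (compress alpha (os_mx x)).
have yE : os_mx y = compress alpha (os_mx x).
  exact/of_mxK/compress_hermitian/os_mx_hermitian.
have [/(_ x_pos) y_pos _] := os_compress_le m_gt0 n_gt0 yE.
rewrite mxblock_form.
suff -> : \sum_i \sum_j \sum_p \sum_q (w i 0 p * (w j 0 q)^*) *
    (map_mx dual_map (os_mx x)) i j p q = cplx_ext (os_mx y).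
  by rewrite cplx_ext_hermitian lecR mulr_ge0 ?f_pos.
rewrite yE -dual_map_compress.
do 4! (apply: eq_bigr => ? _).
by rewrite !mxE conjCK.
Qed.

(** The test vector with blocks e_i corresponds to [alpha] the identity, so the quadratic form takes
    the value [2 * f x]. *)
Lemma dual_map_not_psd (x : os_herm S n) : f x < 0 ->
  ~ mx_psd (map_mx dual_map (os_mx x)).
Proof.
move=> fx [_ /(_ (\mxrow_i delta_mx 0 i))].
rewrite mxblock_form.
suff -> : \sum_i \sum_j \sum_p \sum_q
    ((delta_mx 0 i : 'rV_n) 0 p * ((delta_mx 0 j : 'rV_n) 0 q)^*) *
    (map_mx dual_map (os_mx x)) i j p q = cplx_ext (os_mx x).
  by rewrite cplx_ext_hermitian lecR; lra.
have id_x : compress 1%:M (os_mx x) = os_mx x.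
  apply/matrixP => i j; rewrite mxE (bigD1 i) //= (bigD1 j) //=.
  rewrite !mxE !eqxx rmorph1 mul1r scale1r big1 ?addr0.
    rewrite big1 ?addr0 // => k /negPf ki; rewrite big1 // => l _.
    by rewrite !mxE ki rmorph0 mul0r scale0r.
  by move=> l /negPf lj; rewrite !mxE lj mulr0 scale0r.
rewrite -[in RHS]id_x -dual_map_compress.
apply: eq_bigr => i _; apply: eq_bigr => j _.
apply: eq_bigr => p _; apply: eq_bigr => q _.
by rewrite !mxE !eqxx /= ![_ == i]eq_sym ![_ == j]eq_sym !rmorph_nat.
Qed.

(** The 9 is (1 + 2)^2 from [os_compress_le], the entries of [unit_pair_mx] having moduli of sum
    2. *)
Lemma re_ext_unit_mx (e : R) k l s : (forall x, `|f x| <= e * `|x|) -> 0 <= e ->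
  `|re_ext (unit_mx k l s)| <= 9 * e * `|of_mx (offdiag_mx s)|.
Proof.
move=> f_le e0; apply: le_trans (f_le _) _; rewrite [9 * e]mulrC -mulrA.
apply: ler_wpM2l => //.
have [|_] := @os_compress_le _ S _ _ (unit_pair_mx R k l)
    (of_mx (offdiag_mx s)) (of_mx (unit_mx k l s + adjmx (unit_mx k l s)))
    isT n_gt0.
  rewrite !of_mxK ?compress_unit_pair //; first exact: offdiag_hermitian.
  exact: hermitian_adjmx.
by rewrite unit_pair_sum; have -> : (1 + 2) ^+ 2 = 9 :> R by ring.
Qed.

(** Free of [n], so that one bound serves all matrix sizes. The two squares control the real and the
    imaginary parts of the entries of [dual_map s]. *)
Definition trace_bound s : R :=
  1 + `|of_mx (offdiag_mx s)| ^+ 2 + `|of_mx (offdiag_mx ('i%C *: s))| ^+ 2.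

(** The assumed norm of [f] cancels the 9 and leaves at most [c / n%:R ^+ 4] for each squared entry.
    There are n^2 entries, and [trace_norm_le] costs another factor n, so [c / n%:R] remains, which
    is at most [c]. *)
Lemma dual_map_trace_norm s :
  (forall x, `|f x| <= (9 * n%:R ^+ 2)^-1 * `|x|) ->
  trace_norm (dual_map s) <= trace_bound s.
Proof.
move=> f_le; apply: le_trans (trace_norm_le _) _.
have nR : 0 < n%:R :> R by rewrite ltr0n.
have n2 : 0 < n%:R ^+ 2 :> R by rewrite exprn_gt0.
have re_le k l t : re_ext (unit_mx k l t) ^+ 2 <=
    `|of_mx (offdiag_mx t)| ^+ 2 / n%:R ^+ 4.
  have e0 : 0 <= (9 * n%:R ^+ 2)^-1 :> R by rewrite invr_ge0 mulr_ge0 // ltW.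
  have := re_ext_unit_mx k l t f_le e0; rewrite invfM mulrA divff // mul1r => le1.
  rewrite -real_normK ?num_real // (_ : n%:R ^+ 4 = (n%:R ^+ 2) ^+ 2); last by ring.
  rewrite -exprVn -exprMn mulrC; apply: lerXn2r => //.
  by rewrite nnegrE.
set c := `|of_mx (offdiag_mx s)| ^+ 2 + `|of_mx (offdiag_mx ('i%C *: s))| ^+ 2.
have c0 : 0 <= c by rewrite addr_ge0 ?sqr_ge0.
rewrite /trace_bound -addrA lerD2l -/c.
have entry_le k l : Normc.normc (dual_map s k l) ^+ 2 <= c / n%:R ^+ 4.
  rewrite mxE /cplx_ext /= sqr_sqrtr ?addr_ge0 ?sqr_ge0 // sqrrN /c mulrDl.
  apply: lerD; first exact: re_le.
  rewrite (_ : scalemx_os _ _ = unit_mx k l ('i%C *: s)); first exact: re_le.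
  by apply/matrixP => i j; rewrite !mxE; case: ifP; rewrite ?scaler0.
apply: (@le_trans _ _ (n%:R * \sum_(i < n) \sum_(j < n) (c / n%:R ^+ 4))).
  apply: ler_wpM2l; first exact: ltW.
  by do 2 apply: ler_sum => ? _.
have sumE (a : R) : \sum_(i < n) a = n%:R * a.
  by rewrite sumr_const card_ord mulr_natl.
rewrite !sumE.
have -> : n%:R * (n%:R * (n%:R * (c / n%:R ^+ 4))) = c / n%:R.
  by field; exact: lt0r_neq0.
by rewrite ler_pdivrMr // ler_peMr // ler1n.
Qed.

End Functional.

(** * Separation by matrix-valued maps and the embedding *)

Lemma os_pos_separation (R : realType) (S : operatorSystem R) n
    (x : os_herm S n) :
  (0 < n)%N -> ~ os_pos x ->
  exists phi : S -> 'M[R[i]]_n,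
    [/\ linear phi, forall s, phi (star s) = (phi s)^t*,
      forall m (y : os_herm S m), (0 < m)%N -> os_pos y ->
        mx_psd (map_mx phi (os_mx y)),
      forall s, trace_norm (phi s) <= trace_bound s &
      ~ mx_psd (map_mx phi (os_mx x))].
Proof.
move=> n_gt0 nx.
have e_gt0 : 0 < (9 * n%:R ^+ 2)^-1 :> R.
  by rewrite invr_gt0 mulr_gt0 // exprn_gt0 // ltr0n.
have [P_closed P0 PD PZ _ _] := os_regular S n_gt0.
have [f [f_lin f_pos fx f_le]] := cone_separation P_closed P0 PD PZ nx e_gt0.
exists (dual_map f); split.
- exact: dual_map_linear.
- exact: dual_map_star.
- exact: dual_map_cp.
- by move=> s; exact: dual_map_trace_norm.
- exact: dual_map_not_psd.
Qed.

Theorem corollary5p2p9 (R : realType) (S : operatorSystem R) :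
  exists (J : Type) (k : J -> nat) (Psi : S -> matprod R k),
    [/\ (forall i : J, (0 < k i)%N),
        (forall i : J, linear (fun s : S => Psi s i)),
        (forall (i : J) (s : S), Psi (star s) i = (Psi s i)^t*) &
        (forall n : nat, (0 < n)%N -> forall x : os_herm S n,
           os_pos x <-> matprod_pos (map_mx Psi (os_mx x)))].
Proof.
pose admissible n (phi : S -> 'M[R[i]]_n) :=
  [/\ (0 < n)%N, linear phi, forall s, phi (star s) = (phi s)^t*,
    forall m (y : os_herm S m), (0 < m)%N -> os_pos y ->
      mx_psd (map_mx phi (os_mx y)) &
    forall s, trace_norm (phi s) <= trace_bound s].
pose J := {n : nat & {phi : S -> 'M[R[i]]_n | admissible n phi}}.
pose k (i : J) := projT1 i.
pose component_of (s : S) (i : J) : 'M[R[i]]_(k i) := sval (projT2 i) s.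
have bounded s : has_ubound (range (fun i => trace_norm (component_of s i))).
  exists (trace_bound s) => _ [[n [phi [? ? ? ? phi_le]]] _ <-].
  exact: phi_le.
exists J, k, (fun s => Matprod (bounded s)); split.
- by move=> [n [phi []]].
- by move=> [n [phi []]].
- by move=> [n [phi []]].
- move=> n n_gt0 x.
  have PsiE (i : J) : map_mx (fun g : matprod R k => g i)
      (map_mx (fun s => Matprod (bounded s)) (os_mx x)) =
      map_mx (sval (projT2 i)) (os_mx x).
    by apply/matrixP => p q; rewrite !mxE.
  split=> [x_pos i|psd_x].
    rewrite PsiE; case: i => m [phi /= [_ _ _ cp _]]; exact: cp.
  apply: contrapT => /(os_pos_separation n_gt0)[phi [lin st cp le npsd]].
  apply: npsd.
  (* The separating map is itself an index, so positivity of the whole family contradicts it at this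
     component. *)
  pose i : J := existT _ n (exist _ phi (And5 n_gt0 lin st cp le)).
  by have := psd_x i; rewrite PsiE.
Qed.
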